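(* Let $\mathcal{Z}\subseteq\mathbb{R}^p$, let $\mu$ be a probability measure on $\mathcal{Z}$, let $F:\mathcal{Z}\to\mathbb{R}^p$ be a smooth vector field with an equilibrium at the origin, $E=\frac{\partial F}{\partial z}(0)$, $F_n(z)=F(z)-Ez$, and let $\lambda\in\mathbb{R}$ be an eigenvalue of $E$ with left eigenvector $w$, $w^\top E=\lambda w^\top$. Let $\Gamma_M=(\gamma_1,\dots,\gamma_M)^\top$ with $\gamma_j:\mathcal{Z}\to\mathbb{R}$ be basis functions such that $\{\gamma_j\}_{j=1}^M$ are $\mu$-linearly independent and $\{\frac{\partial\gamma_j}{\partial z}F-\lambda\gamma_j\}_{j=1}^M$ are also $\mu$-linearly independent. Let $$\psi_\lambda^{ML}(z)=w^\top z+\Gamma_M^\top(z)\Theta_L^\star,\qquad \psi_\lambda^{M}(z)=w^\top z+\Gamma_M^\top(z)\Theta^\star,$$ where $\Theta^\star=-J_\mu^{-1}b_\mu$ and $\Theta_L^\star=-(J_{\hat\mu_L})^{-1}b_{\hat\mu_L}$, with $J_\mu,b_\mu$ and their empirical counterparts $J_{\hat\mu_L},b_{\hat\mu_L}$, built from $L$ points $z_1,\dots,z_L$ drawn i.i.d. from $\mu$, as defined in the context. Then $$\lim_{L\to\infty}\|\psi_\lambda^{ML}-\psi_\lambda^{M}\|=0,$$ where $\|\cdot\|$ is any norm on $\mathcal{F}_M=\operatorname{span}\{\gamma_1,\dots,\gamma_M\}$.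
   Context: Functions $g_1,\dots,g_M$ are $\mu$-linearly independent if $\mu\{z\in\mathcal{Z}:\sum_jc_jg_j(z)=0\}=0$ for every nonzero $c\in\mathbb{R}^M$. The inner product is $\langle f,g\rangle_{L_2(\mu)}=\int_{\mathcal{Z}}fg\,d\mu$. For $1\le i,j\le M$, $$(J_\mu)_{ij}=\Big\langle\frac{\partial\gamma_j}{\partial z}F-\lambda\gamma_j,\gamma_i\Big\rangle_{L_2(\mu)},\qquad (b_\mu)_i=\langle w^\top F_n,\gamma_i\rangle_{L_2(\mu)},$$ so that $\Theta^\star$ is the unique solution of $J_\mu\Theta=-b_\mu$. It gives the Galerkin projection $\Gamma_M^\top\Theta^\star$ of the nonlinear part $h$ of the principal eigenfunction $\psi_\lambda(z)=w^\top z+h(z)$ of the Koopman generator, i.e. of the function satisfying $\frac{\partial\psi_\lambda}{\partial z}F=\lambda\psi_\lambda$. The empirical counterparts, obtained by replacing $\mu$ with the empirical measure $\hat\mu_L=\frac1L\sum_{k=1}^L\delta_{z_k}$, are $$J_{\hat\mu_L}=\frac1L\sum_{k=1}^L\Gamma_M(z_k)\Big(\frac{\partial\Gamma_M}{\partial z}(z_k)F(z_k)-\lambda\Gamma_M(z_k)\Big)^\top,\qquad b_{\hat\mu_L}=\frac1L\sum_{k=1}^Lw^\top F_n(z_k)\,\Gamma_M(z_k),$$ and $\Theta_L^\star$ is the solution of $J_{\hat\mu_L}\Theta_L=-b_{\hat\mu_L}$. Under the stated assumptions, $J_\mu$ is asserted to be invertible, and $J_{\hat\mu_L}$ is asserted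 to be invertible with probability one for $L\ge M$.
   Formalization: Invertibility of J_μ is assumed: the two μ-linear-independence conditions do not imply it (F=-z+z², λ=-1, γ=1+√5z², μ uniform on [-1,1] gives J_μ=0), and Θ* is then undefined; the functions in the inner products are taken in L2(μ), and the limit is almost sure. *)

(* Defs.v *)
From HB Require Import structures.
From mathcomp Require Import all_boot all_order all_algebra finmap.
From mathcomp Require Import all_classical all_reals all_analysis.

Set Implicit Arguments.
Unset Strict Implicit.
Unset Printing Implicit Defensive.

Import Order.TTheory GRing.Theory Num.Theory.
Import numFieldNormedType.Exports.

Local Open Scope classical_set_scope.
Local Open Scope ring_scope.

(* Points of R^p are row vectors, as the Jacobian ['J F z] expects; the column
   vector of the mathematics is their transpose. *)

Section PhaseSpace.
Context {R : realType} {p : nat}.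

Definition borel_rV : Type := g_sigma_algebraType (@open 'rV[R]_p).

Variable Z : set 'rV[R]_p.

(* The membership proof of the origin is a parameter because the library only
   puts sigma-algebras on pointed types. *)
Definition points (Z0 : Z 0) : Type := set_type Z.
HB.instance Definition _ (Z0 : Z 0) := Choice.on (points Z0).
HB.instance Definition _ (Z0 : Z 0) :=
  isPointed.Build (points Z0) (SigSub (mem_set Z0)).

Definition coord (Z0 : Z 0) (z : points Z0) : borel_rV := set_val z.

(* Z with the trace of the Borel sigma-algebra of R^p; Z itself need not be
   Borel. *)
Definition phase (Z0 : Z 0) : Type := g_sigma_algebra_preimageType (@coord Z0).

Definition pt (Z0 : Z 0) (z : phase Z0) : 'rV[R]_p := set_val (z : points Z0).

End PhaseSpace.

Section Smoothness.
Context {R : realType} {p q : nat}.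

(* [iter_partial F [:: i1; ...; ik]] is d/dz_i1 ... d/dz_ik F. *)
Fixpoint iter_partial (F : 'rV[R]_p -> 'rV[R]_q) (s : seq 'I_p) :
    'rV[R]_p -> 'rV[R]_q :=
  if s is i :: s' then fun z => 'D_(delta_mx 0 i) (iter_partial F s') z else F.

Definition smooth_on (U : set 'rV[R]_p) (F : 'rV[R]_p -> 'rV[R]_q) : Prop :=
  forall (s : seq 'I_p) (z : 'rV[R]_p), U z ->
    {for z, continuous (iter_partial F s)} /\
    forall i : 'I_p, derivable (iter_partial F s) z (delta_mx 0 i).

(* Smoothness on an arbitrary subset Z: F stands for a smooth extension to an
   open neighbourhood of Z.  Values outside that neighbourhood are unused. *)
Definition smooth_near (Z : set 'rV[R]_p) (F : 'rV[R]_p -> 'rV[R]_q) : Prop :=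
  exists U : set 'rV[R]_p, [/\ open U, Z `<=` U & smooth_on U F].

End Smoothness.

Section Measure.
Context {d : measure_display} {T : measurableType d} {R : realType}.

Definition mu_lin_indep (mu : {measure set T -> \bar R}) (M : nat)
    (g : 'I_M -> T -> R) : Prop :=
  forall c : 'cV[R]_M, c != 0 ->
    mu [set z | \sum_(j < M) c j 0 * g j z = 0] = 0%E.

Definition inner_L2 (mu : {measure set T -> \bar R}) (f g : T -> R) : R :=
  \int[mu]_z (f z * g z).

End Measure.

Section Independence.
Context {d d' : measure_display} {Omega : measurableType d}
  {T : measurableType d'} {R : realType}.

Definition mutually_independent (P : probability Omega R)
    (X : nat -> {RV P >-> T}) : Prop :=
  forall (K : {fset nat}) (A : nat -> set T), (forall k, measurable (A k)) ->
    P (\bigcap_(k in [set` K]) X k @^-1` A k) =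
    (\prod_(k <- K) P (X k @^-1` A k))%E.

Definition iid (P : probability Omega R) (mu : probability T R)
    (X : nat -> {RV P >-> T}) : Prop :=
  mutually_independent X /\
  forall k (A : set T), measurable A -> distribution P (X k) A = mu A.

End Independence.

Section Norms.
Context {R : realType} {T : Type}.

Definition span_fct (M : nat) (g : 'I_M -> T -> R) : set (T -> R) :=
  [set f | exists c : 'cV[R]_M, f = fun z => \sum_(j < M) c j 0 * g j z].

(* Nonnegativity follows from these three axioms when S is a subspace. *)
Definition norm_on (S : set (T -> R)) (N : (T -> R) -> R) : Prop :=
  [/\ forall f g, S f -> S g -> N (f + g) <= N f + N g,
      forall (a : R) f, S f -> N (fun z => a * f z) = `|a| * N f &
      forall f, S f -> N f = 0 -> f = 0].

End Norms.

Section Koopman.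
Context {R : realType} {p : nat}.
Variable F : 'rV[R]_p -> 'rV[R]_p.

(* ['J F 0] acts on row vectors from the right, hence the transpose. *)
Definition Emx : 'M[R]_p := ('J F 0)^T.

Definition Fn (z : 'rV[R]_p) : 'rV[R]_p := F z - (Emx *m z^T)^T.

Variables (w : 'cV[R]_p) (lambda : R).

Definition wFn (z : 'rV[R]_p) : R := (w^T *m (Fn z)^T) 0 0.

Context {M : nat}.
Variable gam : 'I_M -> 'rV[R]_p -> R.

Definition koop (j : 'I_M) (z : 'rV[R]_p) : R :=
  'd (gam j) z (F z) - lambda * gam j z.

Definition Gam (z : 'rV[R]_p) : 'cV[R]_M := \col_j gam j z.

Definition Koop (z : 'rV[R]_p) : 'cV[R]_M := \col_j koop j z.

Context {Z : set 'rV[R]_p} {Z0 : Z 0}.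

Section Population.
Variable mu : {measure set (phase Z0) -> \bar R}.

Definition Jmu : 'M[R]_M :=
  \matrix_(i, j) inner_L2 mu (koop j \o @pt _ _ _ Z0) (gam i \o @pt _ _ _ Z0).

Definition bmu : 'cV[R]_M :=
  \col_i inner_L2 mu (wFn \o @pt _ _ _ Z0) (gam i \o @pt _ _ _ Z0).

Definition Theta : 'cV[R]_M := - (invmx Jmu *m bmu).

End Population.

Section Empirical.
Variables (L : nat) (z : 'I_L -> phase Z0).

Definition Jhat : 'M[R]_M :=
  L%:R^-1 *: \sum_(k < L) Gam (pt (z k)) *m (Koop (pt (z k)))^T.

Definition bhat : 'cV[R]_M :=
  L%:R^-1 *: \sum_(k < L) wFn (pt (z k)) *: Gam (pt (z k)).

(* [invmx] is the identity on singular matrices. *)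
Definition ThetaL : 'cV[R]_M := - (invmx Jhat *m bhat).

End Empirical.

Definition psi (theta : 'cV[R]_M) (z : phase Z0) : R :=
  (w^T *m (pt z)^T) 0 0 + ((Gam (pt z))^T *m theta) 0 0.

End Koopman.

(* Main.v *)
(* The entries of the empirical matrix and vector are sample means of products
   of two L2 functions, which are only integrable, so their almost sure
   convergence is Kolmogorov's strong law for L1 functions, proved here with
   Etemadi's method (pairwise independence, nonnegative summands).  Along the
   subsequence q * 2^n, with q fixed, truncating f at level 2^n makes the
   Chebyshev bounds and the truncation errors summable, with sums controlled
   by the mean of f; since every large m lies between q * 2^n and
   (q + 1) * 2^n for some q in [Q, 2Q), monotonicity of the partial sums gives
   the full limit up to a factor 1 + 1/Q.  The population matrix being
   invertible, the empirical coefficients then converge almost surely, and any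
   norm on the span of the gamma_j is dominated by a weighted l1 norm of the
   coefficients. *)

Require Import Defs.
From HB Require Import structures.
From mathcomp Require Import all_boot all_order all_algebra finmap.
From mathcomp Require Import all_classical all_reals all_analysis.
From mathcomp Require Import measurable_realfun.
From mathcomp Require Import lra ring zify.

Set Implicit Arguments.
Unset Strict Implicit.
Unset Printing Implicit Defensive.

Import Order.TTheory GRing.Theory Num.Theory.
Import numFieldNormedType.Exports.

Local Open Scope classical_set_scope.
Local Open Scope ring_scope.

(** * Second moments of sums of pairwise independent variables *)

Section PairwiseIid.
Context {d d' : measure_display} {Omega : measurableType d}
  {T : measurableType d'} {R : realType}.

(** Variances of sums involve only pairs of indices, so this is the form in which independence
    enters the second moment bounds. The joint law is written directly as a product of the common
    law [mu]. *)
Definition pairwise_iid (P : probability Omega R) (mu : probability T R)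
    (X : nat -> {RV P >-> T}) : Prop :=
  (forall k (A : set T), measurable A -> distribution P (X k) A = mu A) /\
  (forall i j (A B : set T), i != j -> measurable A -> measurable B ->
     P (X i @^-1` A `&` X j @^-1` B) = (mu A * mu B)%E).

Lemma iid_pairwise (P : probability Omega R) (mu : probability T R)
    (X : nat -> {RV P >-> T}) : iid mu X -> pairwise_iid mu X.
Proof.
move=> [ind idd]; split=> // i j A B ij mA mB.
(* Mutual independence asks for a set at every index; over the index set {i, j} only these two
   values count. *)
pose C k := if k == i then A else B.
have mC k : measurable (C k) by rewrite /C; case: ifP.
have := ind [fset i; j]%fset C mC.
have nij : i \notin [fset j]%fset by rewrite in_fset1.
rewrite big_fsetU1//= big_seq_fset1.
rewrite /C eqxx eq_sym (negbTE ij) => h.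
rewrite -(idd i A mA) -(idd j B mB) /distribution /pushforward/= -h.
congr (P _); apply/seteqP; split => w /=.
  move=> [Aw Bw] k /=; rewrite !inE => /orP[] /eqP ->.
    by rewrite eqxx.
  by rewrite eq_sym (negbTE ij).
move=> H; split.
  by have := H i; rewrite /= !inE eqxx; exact.
by have := H j; rewrite /= !inE eqxx orbT (eq_sym j) (negbTE ij); exact.
Qed.

Variables (P : probability Omega R) (mu : probability T R)
  (X : nat -> {RV P >-> T}) (X_iid : pairwise_iid mu X).

Lemma ge0_integral_iid (k : nat) (f : T -> \bar R) :
  measurable_fun [set: T] f -> (forall t, 0 <= f t)%E ->
  (\int[P]_w f (X k w) = \int[mu]_t f t)%E.
Proof.
move=> mf f0; rewrite -(ge0_integral_distribution (X k))//.
by apply: eq_measure_integral => A mA _; exact: X_iid.1.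
Qed.

Let pair i j : Omega -> T * T := fun w => (X i w, X j w).

Let mpair i j : measurable_fun [set: Omega] (pair i j).
Proof. by apply: measurable_fun_pair. Qed.

HB.instance Definition _ i j :=
  isMeasurableFun.Build _ _ _ _ (pair i j) (mpair i j).

(** The joint law agrees with the product measure on rectangles, hence everywhere; Tonelli then
    splits the integral. *)
Lemma ge0_integral_iid_pair (i j : nat) (f : T * T -> \bar R) : i != j ->
  measurable_fun [set: T * T] f -> (forall t, 0 <= f t)%E ->
  (\int[P]_w f (X i w, X j w) = \int[mu]_s \int[mu]_t f (s, t))%E.
Proof.
move=> ij mf f0.
rewrite -(fubini_tonelli1 f)//.
rewrite -[LHS](ge0_integral_distribution (pair i j))//.
apply: eq_measure_integral => A mA _.
by apply/esym/product_measure_unique => //= B C mB mC; exact: X_iid.2.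
Qed.

Lemma expectation_iidM (i j : nat) (f g : T -> R) : i != j ->
  measurable_fun [set: T] f -> measurable_fun [set: T] g ->
  (forall t, 0 <= f t) -> (forall t, 0 <= g t) ->
  ('E_P[(f \o X i) * (g \o X j)] = 'E_mu[f] * 'E_mu[g])%E.
Proof.
move=> ij mf mg f0 g0; rewrite unlock.
rewrite (@ge0_integral_iid_pair i j (fun z => (f z.1 * g z.2)%:E))//=;
  first last.
- by move=> t; rewrite lee_fin mulr_ge0.
- apply/measurable_EFinP; apply: measurable_funM; exact: measurableT_comp.
rewrite -ge0_integralZr//; first last.
- by apply: integral_ge0 => x _; rewrite lee_fin.
- by move=> x _; rewrite lee_fin.
- exact/measurable_EFinP.
apply: eq_integral => s _.
rewrite -ge0_integralZl//.
- exact/measurable_EFinP.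
- by move=> x _; rewrite lee_fin.
- by rewrite lee_fin.
Qed.

Lemma expectation_iid (k : nat) (f : T -> R) : measurable_fun [set: T] f ->
  (forall t, 0 <= f t) -> ('E_P[f \o X k] = 'E_mu[f])%E.
Proof.
move=> mf f0; rewrite unlock (@ge0_integral_iid k (EFin \o f))//.
exact/measurable_EFinP.
Qed.

(** The integral of the squared modulus depends only on the law of the variable. *)
Lemma Lfun2_iid (k : nat) (f : T -> R) :
  f \in Lfun mu 2%:E -> f \o X k \in Lfun P 2%:E.
Proof.
rewrite !inE => /andP[/[!inE]/= mf ff]; apply/andP; rewrite !inE/=; split.
  exact: measurableT_comp.
move: ff; rewrite /finite_norm unlock /=.
rewrite (@ge0_integral_iid k (fun t => (`|f t| `^ 2)%:E))//.
apply/measurable_EFinP.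
apply: (@measurableT_comp _ _ _ _ _ _ (fun x : R => x `^ 2)) => //.
exact: measurableT_comp.
Qed.

Lemma covariance_iid (i j : nat) (f : T -> R) : i != j -> f \in Lfun mu 2%:E ->
  (forall t, 0 <= f t) -> covariance P (f \o X i) (f \o X j) = 0%E.
Proof.
move=> ij f2 f0.
have Pfin : P setT \is a fin_num := fin_num_measure P _ measurableT.
have mufin : mu setT \is a fin_num := fin_num_measure mu _ measurableT.
have mf : measurable_fun [set: T] f.
  by move: f2; rewrite inE => /andP[/[!inE]].
rewrite covarianceE ?Lfun2_mul_Lfun1 ?(Lfun_subset12 Pfin) ?Lfun2_iid//.
rewrite expectation_iidM// !expectation_iid// subee//.
by rewrite fin_numM// expectation_fin_num// Lfun_subset12.
Qed.

Let S (f : T -> R) m := \sum_(k < m) (f \o X k).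

Lemma Lfun2_sum_iid (f : T -> R) m : f \in Lfun mu 2%:E ->
  S f m \in Lfun P 2%:E.
Proof.
move=> f2; apply: rpred_sum; rewrite ?lee1n// => hp i _; exact: Lfun2_iid.
Qed.

(** Pairwise covariances vanish, so the variances add up, and each is at most a second moment. *)
Lemma variance_sum_iid (f : T -> R) m : f \in Lfun mu 2%:E ->
  (forall t, 0 <= f t) -> ('V_P[S f m] <= m%:R%:E * 'E_mu[f ^+ 2])%E.
Proof.
move=> f2 f0.
have Pfin : P setT \is a fin_num := fin_num_measure P _ measurableT.
have mufin : mu setT \is a fin_num := fin_num_measure mu _ measurableT.
have mf : measurable_fun [set: T] f.
  by move: f2; rewrite inE => /andP[/[!inE]].
have S0 : S f 0 = cst 0 by rewrite /S big_ord0.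
have cov0 n : covariance P (S f n) (f \o X n) = 0%E.
  (* The length [l] of the sum is freed from [n], so that the induction runs with the last variable
     fixed. *)
  suff H l : (l <= n)%N -> covariance P (S f l) (f \o X n) = 0%E by exact: H.
  elim: l => [_|l IH ln].
    by rewrite S0 covariance_cst_l.
  rewrite /S big_ord_recr/= covarianceDl ?Lfun2_iid ?Lfun2_sum_iid//.
  by rewrite IH ?(ltnW ln)// covariance_iid// ?adde0// ltn_eqF.
elim: m => [|m IH].
  by rewrite S0 variance_cst mul0e.
rewrite /S big_ord_recr/= varianceD ?Lfun2_iid ?Lfun2_sum_iid//.
rewrite cov0 mule0 adde0 -natr1 EFinD muleDl//; last first.
  exact/expectation_fin_num/Lfun2_mul_Lfun1.
rewrite mul1e leeD//.
rewrite varianceE ?Lfun2_iid//.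
rewrite (_ : (f \o X m) ^+ 2 = (f ^+ 2) \o X m)//.
rewrite !expectation_iid//; last 2 first.
- exact: (measurable_funX 2 mf).
- by move=> t; exact: sqr_ge0.
rewrite leeBlDr ?fin_numX//; last first.
  exact/expectation_fin_num/(Lfun_subset12 mufin).
by rewrite leeDl// sqre_ge0.
Qed.

(** Chebyshev's inequality at threshold [e * m]: the variance grows at most linearly in [m] and the
    squared threshold quadratically, which leaves a factor [1 / m]. *)
Lemma weak_law_iid (f : T -> R) (m : nat) (e : R) : f \in Lfun mu 2%:E ->
  (forall t, 0 <= f t) -> (0 < m)%N -> 0 < e ->
  (P [set w | (e * m%:R <=
       `|\sum_(k < m) f (X k w) - m%:R * fine 'E_mu[f]%E|)%R] <=
   ((m%:R * e ^+ 2)^-1)%:E * 'E_mu[f ^+ 2])%E.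
Proof.
move=> f2 f0 m0 e0.
have Pfin : P setT \is a fin_num := fin_num_measure P _ measurableT.
have mufin : mu setT \is a fin_num := fin_num_measure mu _ measurableT.
have mf : measurable_fun [set: T] f.
  by move: f2; rewrite inE => /andP[/[!inE]].
have mS : S f m \in mfun.
  by move: (Lfun2_sum_iid m f2); rewrite inE => /andP[].
have em0 : 0 < e * m%:R by rewrite mulr_gt0// ltr0n.
have ES : ('E_P[S f m] = (m%:R * fine 'E_mu[f]%E)%:E)%E.
  elim: m {m0 mS em0} => [|m IH].
    by rewrite /S big_ord0 mul0r -[0%R]/(cst 0%R) expectation_cst.
  rewrite /S big_ord_recr/= expectationD ?(Lfun_subset12 Pfin)//; last 2 first.
  - exact: Lfun2_sum_iid.
  - exact: Lfun2_iid.
  rewrite IH expectation_iid// -natr1 mulrDl mul1r EFinD fineK//.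
  exact/expectation_fin_num/(Lfun_subset12 mufin).
pose Y : {RV P >-> R} := mfun_Sub mS.
have := chebyshev Y em0.
rewrite /Y/= ES/= => h.
apply: (@le_trans _ _ (((e * m%:R) ^- 2)%:E * 'V_P[S f m])%E).
  apply: le_trans h; rewrite le_eqVlt; apply/orP; left; apply/eqP; congr (P _).
  by apply/seteqP; split => w /=; rewrite /S fct_sumE.
apply: (@le_trans _ _ (((e * m%:R) ^- 2)%:E * (m%:R%:E * 'E_mu[f ^+ 2]))%E).
  by rewrite lee_pmul2l// ?lte_fin ?invr_gt0 ?exprn_gt0// variance_sum_iid.
rewrite muleA -EFinM le_eqVlt; apply/orP; left; apply/eqP; congr (_ %:E * _)%E.
by field; rewrite gt_eqF//= pnatr_eq0 -lt0n m0.
Qed.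

End PairwiseIid.
(** * The strong law of large numbers *)

Section DyadicSums.
Context {R : realFieldType}.

Lemma sum_expr2_lt (x : R) N : 0 <= x ->
  \sum_(n < N) (2 ^+ n * (2 ^+ n < x)%R%:R) <= 2 * x.
Proof.
move=> x0.
(* The second bound carries the induction: when [2 ^ N < x], adding [2 ^ N] to a sum of at most
   [2 ^ N] stays below [2 * x]. *)
have [//] : \sum_(n < N) (2 ^+ n * (2 ^+ n < x)%R%:R) <= 2 * x /\
          \sum_(n < N) (2 ^+ n * (2 ^+ n < x)%R%:R) <= 2 ^+ N :> R.
elim: N => [|N [IH1 IH2]].
  by rewrite big_ord0 expr0; split; [exact: mulr_ge0 | exact: ler01].
rewrite big_ord_recr/= exprS; have e0 : 0 < (2 : R) ^+ N by rewrite exprn_gt0.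
by case: ltP => h; rewrite /= ?mulr1 ?mulr0; split; lra.
Qed.

(** The terms vanish until [2 ^ n] reaches [x], and then form a geometric series of ratio 1/2 whose
    first term is at most [x]. *)
Lemma sum_exprV2_le (x : R) N : 0 <= x ->
  \sum_(n < N) ((2 : R) ^- n * (x ^+ 2 * (x <= 2 ^+ n)%R%:R)) <= 2 * x.
Proof.
move=> x0.
have e0 n : 0 < (2 : R) ^- n by rewrite invr_gt0 exprn_gt0.
(* The invariant keeps the unused tail [2 x^2 / 2^N] of the geometric series. *)
suff : \sum_(n < N) ((2 : R) ^- n * (x ^+ 2 * (x <= 2 ^+ n)%R%:R)) = 0 \/
       \sum_(n < N) ((2 : R) ^- n * (x ^+ 2 * (x <= 2 ^+ n)%R%:R)) <=
         2 * x - 2 * (x ^+ 2 * 2 ^- N).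
  have := mulr_ge0 (sqr_ge0 x) (ltW (e0 N)).
  by move=> ? [->|?]; lra.
elim: N => [|N IH]; first by rewrite big_ord0; left.
have eS : (2 : R) ^- N.+1 = 2 ^- N / 2 by rewrite exprS invfM mulrC.
rewrite big_ord_recr/= eS.
case: (leP x (2 ^+ N)) => h; rewrite /= ?mulr1 ?mulr0 ?addr0; last first.
  case: IH => [->|IH]; first by left.
  right; apply: le_trans IH _.
  have := mulr_ge0 (sqr_ge0 x) (ltW (e0 N)); lra.
right; case: IH => [->|IH]; last by lra.
have : x ^+ 2 * 2 ^- N <= x.
  rewrite ler_pdivrMr ?exprn_gt0// expr2.
  exact: ler_wpM2l.
lra.
Qed.

End DyadicSums.

Lemma nneseries_lty {R : realType} (u : nat -> \bar R) (C : R) :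
  (forall n, 0 <= u n)%E -> (forall N, \sum_(n < N) u n <= C%:E)%E ->
  (\sum_(n <oo) u n < +oo)%E.
Proof.
move=> u0 uC; apply: (@le_lt_trans _ _ C%:E); last by rewrite ltry.
apply: lime_le; first by apply: is_cvg_nneseries => n _ _; exact: u0.
by apply: nearW => N; rewrite big_mkord.
Qed.

(** Monotonicity traps [S m] between its values at consecutive multiples of [2 ^ n]. With [2 ^ n] at
    most [m / Q], these multiples differ from [m] by at most [m / Q], so both values divided by [m]
    are close to [a]. *)
Lemma cvg_mean_dyadic {R : realType} (S : nat -> R) (a : R) :
  {homo S : m n / (m <= n)%N >-> m <= n} -> 0 <= a ->
  (forall q e, (0 < q)%N -> 0 < e -> \forall n \near \oo,
     `|S (q * 2 ^ n)%N - (q * 2 ^ n)%:R * a| <= e * (q * 2 ^ n)%:R) ->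
  S m / m%:R @[m --> \oo] --> a.
Proof.
move=> Snd a0 h; apply/cvgrPdist_le => e e0.
(* [e / 3] pays for one dyadic block [2 ^ n <= m / Q] at rate [a]. *)
pose Q := (Num.truncn (3 * a / e)).+1.
have Qe : a <= e / 3 * Q%:R.
  by have := truncnS_gt (3 * a / e); rewrite -/Q ltr_pdivrMr// => ?; lra.
(* The upper multiple [q.+1 * 2 ^ n] is at most [2 * m], so a deviation at rate [e / 9] costs at
   most [2 * e / 9 * m], which leaves room for the block. *)
have e90 : 0 < e / 9 by lra.
(* Only finitely many [q] occur, so one threshold in [n] serves them all; [2 * Q] is included
   because the upper multiple uses [q.+1]. *)
have : \forall n \near \oo, forall q : 'I_(2 * Q).+1, (0 < q)%N ->
    `|S (q * 2 ^ n)%N - (q * 2 ^ n)%:R * a| <= e / 9 * (q * 2 ^ n)%:R.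
  apply: filter_forall => q.
  have [->|q0] := posnP q; first exact: nearW.
  by have := h q _ q0 e90; apply: filterS.
move=> [n0 _ hn0]; exists (Q * 2 ^ n0)%N => // m /= m_ge.
have Q0 : (0 < Q)%N by [].
(* The largest exponent with [Q * 2 ^ n <= m]; its maximality yields [Q <= q < 2 * Q] below. *)
pose n := trunc_log 2 (m %/ Q).
have mQ : (2 ^ n0 <= m %/ Q)%N by rewrite leq_divRL// mulnC.
have mQ0 : (0 < m %/ Q)%N by apply: leq_trans mQ; rewrite expn_gt0.
have n_le : (2 ^ n <= m %/ Q)%N by exact: trunc_logP.
have n_gt : (m %/ Q < 2 ^ n.+1)%N by exact: trunc_log_ltn.
have n0n : (n0 <= n)%N by apply: trunc_log_max.
have e2n : (0 < 2 ^ n)%N by rewrite expn_gt0.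
pose q := (m %/ 2 ^ n)%N.
have qQ : (Q <= q)%N by rewrite leq_divRL// mulnC -leq_divRL.
have q2Q : (q < 2 * Q)%N.
  rewrite ltn_divLR// mulnAC -expnS.
  by rewrite -ltn_divLR.
have q0 : (0 < q)%N by exact: leq_trans qQ.
have lo : (q * 2 ^ n <= m)%N by exact: leq_trunc_div.
have hi : (m < q.+1 * 2 ^ n)%N by rewrite -ltn_divLR.
have Qm : (Q * 2 ^ n <= m)%N by rewrite mulnC -leq_divRL.
have := hn0 n n0n (inord q); rewrite inordK; last lia.
move=> /(_ q0) hq.
have := hn0 n n0n (inord q.+1); rewrite inordK; last lia.
move=> /(_ isT) hq1.
have S1 := Snd _ _ lo; have S2 := Snd _ _ (ltnW hi).
have m0 : 0 < m%:R :> R by rewrite ltr0n; lia.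
have hlo : (q * 2 ^ n)%:R <= m%:R :> R by rewrite ler_nat.
have hhi : m%:R <= (q * 2 ^ n)%:R + (2 ^ n)%:R :> R.
  by rewrite -natrD ler_nat; lia.
have hQm : Q%:R * (2 ^ n)%:R <= m%:R :> R by rewrite -natrM ler_nat.
have e2m : (2 ^ n)%:R <= m%:R :> R.
  apply: le_trans hQm; rewrite ler_peMl ?ler0n// ler1n//.
rewrite mulSnr natrD in hq1.
have a2n : a * (2 ^ n)%:R <= e / 3 * m%:R.
  apply: (@le_trans _ _ (e / 3 * Q%:R * (2 ^ n)%:R)).
    by rewrite ler_wpM2r.
  by rewrite -mulrA ler_wpM2l//; lra.
have -> : a - S m / m%:R = (a * m%:R - S m) / m%:R.
  by field; rewrite gt_eqF.
rewrite normrM [X in _ * X]gtr0_norm ?invr_gt0// ler_pdivrMr//.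
move: hq hq1; rewrite !ler_norml => /andP[hq _] /andP[_ hq1].
have am1 := ler_wpM2l a0 hlo; have am2 := ler_wpM2l a0 hhi.
have em1 := ler_wpM2l (ltW e90) hlo; have em2 := ler_wpM2l (ltW e90) e2m.
have em := mulr_gt0 e0 m0; rewrite mulSnr in S2.
by apply/andP; split; lra.
Qed.

Section StrongLaw.
Context {d d' : measure_display} {Omega : measurableType d}
  {T : measurableType d'} {R : realType}.
Variables (P : probability Omega R) (mu : probability T R)
  (X : nat -> {RV P >-> T}) (X_iid : pairwise_iid mu X).

(** Large values are set to 0 rather than clipped to the level: the square is then [f ^ 2] times the
    same indicator, as in [sum_exprV2_le]. *)
Let tr (f : T -> R) n t : R := f t * (f t <= 2 ^+ n)%R%:R.

Let tr_ge0 f n t : (forall t, 0 <= f t) -> 0 <= tr f n t.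
Proof. by move=> f0; rewrite mulr_ge0. Qed.

Let measurable_level (f : T -> R) n : measurable_fun [set: T] f ->
  measurable [set t | 2 ^+ n < f t].
Proof.
move=> mf; rewrite -[X in measurable X]setTI.
rewrite (_ : [set t | _] = f @^-1` `]2 ^+ n, +oo[%classic); last first.
  by apply/seteqP; split => t /=; rewrite in_itv/= andbT.
exact: mf.
Qed.

Let measurable_tr (f : T -> R) n : measurable_fun [set: T] f ->
  measurable_fun [set: T] (tr f n).
Proof.
move=> mf.
rewrite (_ : tr f n = f \* (\1_(~` [set t | 2 ^+ n < f t]) : T -> R)).
  apply: measurable_funM => //; apply: measurable_indic; apply: measurableC.
  exact: measurable_level.
apply/funext => t; rewrite /tr /= indicE.
congr (_ * (nat_of_bool _)%:R); apply/idP/idP => [h|/set_mem/= /negP].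
  by apply/mem_set => /=; apply/negP; rewrite -leNgt.
by rewrite -leNgt.
Qed.

(** The truncation is bounded by [2 ^ n], and the total mass is 1. *)
Let Lfun2_tr (f : T -> R) n : measurable_fun [set: T] f ->
  (forall t, 0 <= f t) -> tr f n \in Lfun mu 2%:E.
Proof.
move=> mf f0; rewrite inE; apply/andP; rewrite !inE/=; split.
  exact: measurable_tr.
rewrite /finite_norm unlock poweR_lty//.
apply: (@le_lt_trans _ _ (\int[mu]_t (cst ((2 ^+ n) `^ 2)%:E t))%E); last first.
  rewrite integral_cst//  [X in (_ * X)%E](_ : _ = 1%E) ?mule1 ?ltry//.
  exact: (probability_setT mu).
apply: ge0_le_integral => //.
- by move=> t _; rewrite lee_fin powR_ge0.
- apply/measurable_EFinP.
  apply: (@measurableT_comp _ _ _ _ _ _ (fun x : R => x `^ 2)) => //.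
  by apply: measurableT_comp => //; exact: measurable_tr.
- move=> t _; rewrite lee_fin ge0_ler_powR ?nnegrE ?exprn_ge0//.
  rewrite ger0_norm ?tr_ge0// /tr.
  by case: (leP (f t)); rewrite ?mulr1 ?mulr0 ?exprn_ge0.
Qed.

Variables (f : T -> R) (mf : measurable_fun [set: T] f)
  (f0 : forall t, 0 <= f t).

Let S m w : R := \sum_(k < m) f (X k w).
(* [A]: the truncated sum deviates from its mean; [B]: the truncation is active.
   [u] has a mean bounding the probability of their union, and its sum over [n]
   is at most a constant times [f]. *)
Let A (q : nat) (e : R) n : set Omega := [set w | e * (q * 2 ^ n)%:R <=
  `|\sum_(k < (q * 2 ^ n)%N) tr f n (X k w) -
    (q * 2 ^ n)%:R * fine ('E_mu[tr f n])%E| ].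
Let B (q : nat) n : set Omega := \big[setU/set0]_(k < (q * 2 ^ n)%N)
  (X k @^-1` [set t | 2 ^+ n < f t]).
Let u (q : nat) (e : R) n t : R :=
  (q%:R * e ^+ 2)^-1 * ((2 : R) ^- n * tr f n t ^+ 2) +
  q%:R * ((2 : R) ^+ n * (2 ^+ n < f t)%R%:R).

Let measurable_A q e n : measurable (A q e n).
Proof.
rewrite -[A q e n]setTI.
pose g w := `|\sum_(k < (q * 2 ^ n)%N) tr f n (X k w) -
    (q * 2 ^ n)%:R * fine ('E_mu[tr f n])%E|.
have mg : measurable_fun [set: Omega] g.
  apply: measurableT_comp => //; apply: measurable_funB => //.
  apply: measurable_sum => k; apply: (measurableT_comp (measurable_tr n mf)).
  by [].
rewrite (_ : A q e n = g @^-1` `[e * (q * 2 ^ n)%:R, +oo[%classic).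
  exact: mg.
by apply/seteqP; split => t /=; rewrite in_itv/= andbT.
Qed.

Let measurable_B q n : measurable (B q n).
Proof.
apply: bigsetU_measurable => k _; rewrite -[X in measurable X]setTI.
by apply: measurable_funPT => //; exact: measurable_level.
Qed.

Let u_ge0 q e n t : 0 < e -> 0 <= u q e n t.
Proof.
move=> e0; rewrite addr_ge0// mulr_ge0 ?invr_ge0 ?mulr_ge0//;
  rewrite ?exprn_ge0 ?ler0n ?invr_ge0 ?(ltW e0)// ?exprn_ge0 ?tr_ge0//.
Qed.

Let ltE n : (fun t => (2 ^+ n < f t)%R%:R : R) = \1_[set t | 2 ^+ n < f t].
Proof.
apply/funext => t; rewrite indicE; congr (nat_of_bool _)%:R.
by apply/idP/idP => [h|/set_mem//]; exact/mem_set.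
Qed.

Let measurable_lt n :
  measurable_fun [set: T] (fun t => (2 ^+ n < f t)%R%:R : R).
Proof. by rewrite ltE; apply: measurable_indic; exact: measurable_level. Qed.

Let measurable_u q e n : measurable_fun [set: T] (u q e n).
Proof.
apply: measurable_funD; apply: measurable_funM => //.
  apply: measurable_funM => //; apply: measurable_funX; exact: measurable_tr.
by apply: measurable_funM.
Qed.

(** Chebyshev's inequality bounds [A] and the union bound handles [B]; both bounds are integrals
    against [mu], whose integrands add up to [u]. *)
Let P_AB q e n : (0 < q)%N -> 0 < e ->
  (P (A q e n `|` B q n) <= \int[mu]_t (u q e n t)%:E)%E.
Proof.
move=> q0 e0.
have mlevel := measurable_level n mf.
have m0 : (0 < q * 2 ^ n)%N by rewrite muln_gt0 q0 expn_gt0.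
have PA := weak_law_iid X_iid (Lfun2_tr n mf f0) (fun t => tr_ge0 n t f0) m0 e0.
have PB : (P (B q n) <= (q * 2 ^ n)%:R%:E * mu [set t | 2 ^+ n < f t]%R)%E.
  have mBk k : measurable (X k @^-1` [set t | 2 ^+ n < f t]).
    by rewrite -[X in measurable X]setTI; exact: measurable_funPT.
  apply: (le_trans (@Boole_inequality _ _ _ P
    (fun k => X k @^-1` [set t | 2 ^+ n < f t]) _ _)).
    by move=> k _; exact: mBk.
  rewrite (eq_bigr (fun=> mu [set t | 2 ^+ n < f t])); last first.
    by move=> k _; rewrite -(X_iid.1 k).
  by rewrite mule_natl sumr_const card_ord.
apply: (le_trans (measureU2 _ _ _)) => //.
apply: (le_trans (leeD PA PB)).
have muE : mu [set t | 2 ^+ n < f t] =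
    (\int[mu]_t ((2 ^+ n < f t)%R%:R : R)%:E)%E.
  rewrite -[X in mu X]setIT -integral_indic// -ltE; exact: eq_integral.
have mt2 : measurable_fun [set: T] (fun t => tr f n t ^+ 2).
  by apply: measurable_funX; exact: measurable_tr.
have e20 : 0 <= e ^+ 2 := sqr_ge0 e.
have c0 : 0 <= ((q * 2 ^ n)%:R * e ^+ 2)^-1 by rewrite invr_ge0 mulr_ge0.
rewrite unlock muE -!ge0_integralZl_EFin//; first last.
- exact/measurable_EFinP.
- by move=> x _; rewrite lee_fin; exact: sqr_ge0.
- exact/measurable_EFinP.
rewrite -ge0_integralD//; first last.
- by apply: measurable_funeM; exact/measurable_EFinP.
- by apply: measurable_funeM; exact/measurable_EFinP.
- by move=> t _; rewrite -EFinM lee_fin mulr_ge0// sqr_ge0.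
rewrite le_eqVlt; apply/orP; left; apply/eqP; apply: eq_integral => t _.
rewrite -!EFinM -EFinD; congr EFin.
rewrite /u natrM natrX; congr (_ + _); last by rewrite -mulrA.
rewrite [RHS]mulrA -invfM; congr (_^-1 * _); ring.
Qed.

Hypothesis f_int : mu.-integrable [set: T] (EFin \o f).

(** After exchanging sum and integral, the two dyadic sums bound every partial sum of [u] pointwise
    by a constant multiple of [f], whose integral is finite. *)
Let P_AB_sum q e : (0 < q)%N -> 0 < e ->
  (\sum_(n <oo) P (A q e n `|` B q n) < +oo)%E.
Proof.
move=> q0 e0.
have C0 : 0 <= 2 * ((q%:R * e ^+ 2)^-1 + q%:R).
  by rewrite mulr_ge0// addr_ge0// invr_ge0 mulr_ge0// sqr_ge0.
have mF : measurable_fun [set: T] (EFin \o f) by exact/measurable_EFinP.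
have mu1 n : measurable_fun [set: T] (fun t => (u q e n t)%:E).
  by apply/measurable_EFinP; exact: measurable_u.
apply: (@nneseries_lty _ _
  (2 * ((q%:R * e ^+ 2)^-1 + q%:R) * fine (\int[mu]_t (f t)%:E)%E)).
  by [].
move=> N.
apply: (@le_trans _ _ (\sum_(n < N) \int[mu]_t (u q e n t)%:E)%E).
  by apply: lee_sum => n _; exact: P_AB.
rewrite -ge0_integral_sum//; last first.
  by move=> n t _; rewrite lee_fin; exact: u_ge0.
rewrite EFinM fineK; last exact: integrable_fin_num.
rewrite -ge0_integralZl_EFin//; last by move=> t _; rewrite lee_fin.
apply: ge0_le_integral => //.
- by move=> t _; apply: sume_ge0 => n _; rewrite lee_fin; exact: u_ge0.
- by apply: emeasurable_sum => n.
- by apply: measurable_funeM.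
move=> t _; rewrite sumEFin -EFinM lee_fin big_split/= -!mulr_sumr.
have h1 := sum_exprV2_le N (f0 t); have h2 := sum_expr2_lt N (f0 t).
have -> : \sum_(n < N) (2 : R) ^- n * tr f n t ^+ 2 =
    \sum_(n < N) (2 : R) ^- n * (f t ^+ 2 * (f t <= 2 ^+ n)%R%:R).
  apply: eq_bigr => n _; rewrite exprMn.
  by case: (f t <= _); rewrite ?expr1n ?expr0n.
have c0 : 0 <= (q%:R * e ^+ 2)^-1 by rewrite invr_ge0 mulr_ge0// sqr_ge0.
apply: (le_trans (lerD (ler_wpM2l c0 h1) (ler_wpM2l (ler0n _ q) h2))).
by rewrite le_eqVlt; apply/orP; left; apply/eqP; ring.
Qed.

(** Borel-Cantelli: almost surely [A] or [B] occurs for finitely many [n] only, and outside [B] the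
    truncated and full sums coincide. The centering is still the truncated mean. *)
Let truncated_law_subseq q e : (0 < q)%N -> 0 < e ->
  {ae P, forall w, \forall n \near \oo,
    `|S (q * 2 ^ n) w - (q * 2 ^ n)%:R * fine ('E_mu[tr f n])%E|
      < e * (q * 2 ^ n)%:R}.
Proof.
move=> q0 e0.
have mAB n : measurable (A q e n `|` B q n) by exact: measurableU.
exists (lim_sup_set (fun n => A q e n `|` B q n)); split.
- by apply: bigcap_measurable => // k _; apply: bigcup_measurable.
- by apply: lim_sup_set_cvg0 => //; exact: P_AB_sum.
move=> w; apply: contra_notP => /= wE.
have [N [_ wN]] : exists N, True /\ ~ (\bigcup_(j >= N) (A q e j `|` B q j)) w.
  apply: contra_notP wE => H N _; apply: contra_notP H => H.
  by exists N.
exists N => // n /= Nn.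
have /not_orP[nA nB] : ~ (A q e n w \/ B q n w).
  by move=> H; apply: wN; exists n.
have fle k : (k < q * 2 ^ n)%N -> f (X k w) <= 2 ^+ n.
  move=> kq; rewrite leNgt; apply/negP => fk; apply: nB.
  rewrite /B -(bigcup_mkord _ (fun k => X k @^-1` [set t | 2 ^+ n < f t])).
  by exists k.
move/negP: nA; rewrite -ltNge => nA; apply: le_lt_trans nA.
rewrite /S le_eqVlt; apply/orP; left; apply/eqP; congr (`|_ - _|).
by apply: eq_bigr => k _; rewrite /tr fle// mulr1.
Qed.

(** Dominated convergence, with [f] as dominating function; at each point the truncation is
    eventually inactive. *)
Let cvg_mean_tr : fine ('E_mu[tr f n])%E @[n --> \oo] --> \int[mu]_t f t.
Proof.
have mF : measurable_fun [set: T] (EFin \o f) by exact/measurable_EFinP.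
have H : (\int[mu]_t (tr f n t)%:E)%E @[n --> \oo] --> (\int[mu]_t (f t)%:E)%E.
  apply: (@dominated_cvg _ _ _ mu _ measurableT _ _ (EFin \o f)) => //.
  - by move=> n; apply/measurable_EFinP; exact: measurable_tr.
  - move=> t _; apply: cvg_near_cst.
    exists (Num.truncn (f t)) => // n /= hn; rewrite /tr.
    suff -> : f t <= 2 ^+ n by rewrite mulr1.
    apply: ltW; apply: lt_le_trans (truncnS_gt _) _.
    rewrite -natrX ler_nat; apply: leq_trans (ltn_expl _ _) => //.
  - move=> n t _ /=; rewrite lee_fin ger0_norm ?tr_ge0// /tr.
    by case: (f t <= _); rewrite ?mulr1// mulr0.
rewrite unlock; apply: fine_cvg; rewrite fineK//.
exact: integrable_fin_num.
Qed.

Lemma strong_law_ge0 :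
  {ae P, forall w, (\sum_(k < m) f (X k w)) / m%:R @[m --> \oo]
    --> \int[mu]_t f t}.
Proof.
(* Multipliers [q.+1] and tolerances [1 / i.+1] form a countable family, so a single null set serves
   them all. *)
have : {ae P, forall w, forall q i, \forall n \near \oo,
    `|S (q.+1 * 2 ^ n) w - (q.+1 * 2 ^ n)%:R * fine ('E_mu[tr f n])%E|
      < i.+1%:R^-1 * (q.+1 * 2 ^ n)%:R}.
  apply: ae_foralln => q; apply: ae_foralln => i.
  by apply: truncated_law_subseq => //; rewrite invr_gt0.
apply: filterS => w hw; apply: cvg_mean_dyadic.
- move=> m n mn; rewrite -(subnKC mn) big_split_ord/= lerDl.
  exact: sumr_ge0.
- by apply: Rintegral_ge0 => t _.
move=> [//|q] e _ e0.
(* One half of [e] pays for the deviation from the truncated mean, the other for the bias of that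
   mean. *)
have [i ie] : exists i : nat, i.+1%:R^-1 <= e / 2.
  exists (Num.truncn (2 / e)).
  rewrite -[leRHS]invrK lef_pV2 ?posrE ?invr_gt0//; last lra.
  by rewrite invf_div; apply: ltW; exact: truncnS_gt.
have e2 : 0 < e / 2 by lra.
move/cvgrPdist_le : cvg_mean_tr => /(_ _ e2).
apply: filterS2 (hw q i) => n hn1 hn2.
set Q := (q.+1 * 2 ^ n)%:R in hn1 *.
have Q0 : 0 <= Q by [].
set a := fine _ in hn1 hn2 *.
have -> : S (q.+1 * 2 ^ n) w - Q * (\int[mu]_t f t) =
  (S (q.+1 * 2 ^ n) w - Q * a) - Q * (\int[mu]_t f t - a) by ring.
apply: le_trans (ler_normB _ _) _.
rewrite normrM (ger0_norm Q0).
have h1 := ler_wpM2l Q0 hn2; have h2 := ler_wpM2l Q0 ie.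
rewrite [leRHS](_ : _ = Q * (e / 2) + Q * (e / 2)); last by field.
by apply: lerD h1; apply: le_trans (ltW hn1) _; rewrite mulrC.
Qed.

End StrongLaw.

Theorem strong_law {d d' : measure_display} {Omega : measurableType d}
    {T : measurableType d'} {R : realType} (P : probability Omega R)
    (mu : probability T R) (X : nat -> {RV P >-> T}) (f : T -> R) :
  pairwise_iid mu X -> mu.-integrable [set: T] (EFin \o f) ->
  {ae P, forall w, (\sum_(k < m) f (X k w)) / m%:R @[m --> \oo]
    --> \int[mu]_t f t}.
Proof.
move=> X_iid f_int.
have mf : measurable_fun [set: T] f.
  by case/integrableP : f_int => /measurable_EFinP.
(* [f = (f + |f|) - |f|] with both terms nonnegative and integrable. *)
pose g t := `|f t|; pose h t := f t + g t.
have g_int : mu.-integrable [set: T] (EFin \o g) by exact: integrable_norm.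
have h_int : mu.-integrable [set: T] (EFin \o h).
  exact: (integrableD measurableT f_int g_int).
have mg : measurable_fun [set: T] g by exact: measurableT_comp.
have mh : measurable_fun [set: T] h by exact: measurable_funD.
have g0 t : 0 <= g t by exact: normr_ge0.
have h0 t : 0 <= h t by rewrite /h /g addrC -lerBlDr sub0r -normrN ler_norm.
have fE t : f t = h t - g t by rewrite /h addrK.
apply: filterS2 (strong_law_ge0 X_iid mg g0 g_int)
  (strong_law_ge0 X_iid mh h0 h_int).
move=> w gw hw.
have -> : \int[mu]_t f t = \int[mu]_t h t - \int[mu]_t g t.
  by rewrite -RintegralB//; apply: eq_Rintegral => t _.
under eq_fun => m.
  rewrite (eq_bigr (fun k : 'I_m => h (X k w) - g (X k w))) => [|k _];
    last exact: fE.
  rewrite sumrB mulrBl.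
  over.
exact: cvgB.
Qed.

(** * Convergence of matrices and of elements of the span *)

(** By the Leibniz formula the determinant is a polynomial in the entries. *)
Lemma cvg_det {R : realType} n (A : nat -> 'M[R]_n) (B : 'M[R]_n) :
  (forall i j, A k i j @[k --> \oo] --> B i j) ->
  \det (A k) @[k --> \oo] --> \det B.
Proof.
move=> AB; apply: cvg_big => [|s _]; first exact: add_continuous.
apply: cvgM; first exact: cvg_cst.
by apply: cvg_big => [|i _]; [exact: mul_continuous|exact: AB].
Qed.

(** The adjugate formula writes each entry of the inverse as a quotient of determinants, continuous
    where the denominator is nonzero. *)
Lemma cvg_invmx {R : realType} n (A : nat -> 'M[R]_n) (B : 'M[R]_n) :
  B \in unitmx ->
  (forall i j, A k i j @[k --> \oo] --> B i j) ->
  forall i j, invmx (A k) i j @[k --> \oo] --> invmx B i j.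
Proof.
move=> Bu AB i j.
have dB : \det B != 0 by rewrite -unitfE -unitmxE.
have dA := cvg_det AB.
(* [invmx] returns a singular matrix unchanged, so the formula is available only once the
   determinants have left 0. *)
have Au : \forall k \near \oo, A k \in unitmx.
  move/cvgr_neq0 : (dA) => /(_ dB); apply: filterS => k.
  by rewrite unitmxE unitfE.
have invE (C : 'M[R]_n) : C \in unitmx ->
    invmx C i j = (\det C)^-1 * ((-1) ^+ (j + i) * \det (row' j (col' i C))).
  by move=> Cu; rewrite /invmx Cu !mxE.
rewrite (invE B Bu).
apply: (@cvg_trans _ ((fun k => (\det (A k))^-1 *
    ((-1) ^+ (j + i) * \det (row' j (col' i (A k))))) @ \oo)).
  apply: near_eq_cvg; apply: filterS Au => k Aku.
  by rewrite invE.
apply: cvgM; first exact: cvgV.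
apply: cvgM; first exact: cvg_cst.
apply: cvg_det => k l; rewrite !mxE.
under eq_fun do rewrite !mxE.
exact: AB.
Qed.

Lemma cvg_mulmx {R : realType} m n p (A : nat -> 'M[R]_(m, n))
    (B : nat -> 'M[R]_(n, p)) (A0 : 'M[R]_(m, n)) (B0 : 'M[R]_(n, p)) :
  (forall i j, A k i j @[k --> \oo] --> A0 i j) ->
  (forall i j, B k i j @[k --> \oo] --> B0 i j) ->
  forall i j, (A k *m B k) i j @[k --> \oo] --> (A0 *m B0) i j.
Proof.
move=> AA BB i j; rewrite mxE; under eq_fun do rewrite mxE.
apply: cvg_big => [|l _]; first exact: add_continuous.
by apply: cvgM; [exact: AA|exact: BB].
Qed.

Section SpanNorm.
Context {R : realType} {T : Type} {M : nat}.
Variables (g : 'I_M -> T -> R) (N : (T -> R) -> R).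
Hypothesis N_norm : norm_on (span_fct g) N.

Let comb (c : 'cV[R]_M) : T -> R := fun z => \sum_(j < M) c j 0 * g j z.

Let span_comb c : span_fct g (comb c). Proof. by exists c. Qed.

Let N0 : N 0 = 0.
Proof.
have [_ + _] := N_norm.
move=> /(_ 0 _ (span_comb 0)); rewrite normr0 mul0r => <-; congr N.
by apply/funext => z; rewrite mul0r.
Qed.

(** The triangle inequality for [f] and [-f] gives [0 = N 0 <= 2 * N f]. *)
Let N_ge0 c : 0 <= N (comb c).
Proof.
have [tri hom _] := N_norm.
have := hom (-1) _ (span_comb c); rewrite normrN1 mul1r => hN.
have sN : span_fct g (fun z => -1 * comb c z).
  exists (- c); apply/funext => z; rewrite mulN1r -sumrN.
  by apply: eq_bigr => j _; rewrite mxE mulNr.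
have := tri _ _ (span_comb c) sN; rewrite hN (_ : _ + _ = 0) ?N0; first by lra.
by apply/funext => z; rewrite fctE/= mulN1r subrr.
Qed.

Let N_comb_le c : N (comb c) <= \sum_(j < M) `|c j 0| * N (g j).
Proof.
have [tri hom _] := N_norm.
have sg j (a : R) : span_fct g (fun z => a * g j z).
  exists (a *: delta_mx j 0); apply/funext => z.
  rewrite (bigD1 j)//= !mxE !eqxx mulr1 big1 ?addr0// => i ij.
  by rewrite !mxE (negbTE ij) mulr0 mul0r.
have sg1 j : span_fct g (g j).
  by have := sg j 1; congr (span_fct g _); apply/funext => z; rewrite mul1r.
(* The norm axioms hold on the span only, so the induction also carries membership of the partial
   sums. *)
have H (s : seq 'I_M) : span_fct g (\sum_(j <- s) (fun z => c j 0 * g j z)) /\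
    N (\sum_(j <- s) (fun z => c j 0 * g j z)) <=
      \sum_(j <- s) `|c j 0| * N (g j).
  elim: s => [|j s [sS IH]].
    rewrite !big_nil N0; split=> //; exists 0; apply/funext => z.
    by rewrite big1// => j _; rewrite mxE mul0r.
  rewrite !big_cons; split.
    have [c1 e1] := sg j (c j 0); have [c2 e2] := sS; exists (c1 + c2).
    rewrite e1 e2; apply/funext => z; rewrite fctE -big_split/=.
    by apply: eq_bigr => i _; rewrite mxE mulrDl.
  by apply: le_trans (tri _ _ (sg _ _) sS) _; rewrite hom// lerD2l.
have [_] := H (index_enum 'I_M); congr (N _ <= _).
by apply/funext => z; rewrite fct_sumE.
Qed.

Lemma cvg_span_norm (c : nat -> 'cV[R]_M) :
  (forall j, c k j 0 @[k --> \oo] --> (0 : R)) ->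
  N (fun z => \sum_(j < M) c k j 0 * g j z) @[k --> \oo] --> (0 : R).
Proof.
move=> c0; apply: (@squeeze_cvgr _ _ _ _ (fun=> 0)
    (fun k => \sum_(j < M) `|c k j 0| * N (g j))).
- by apply: nearW => k; rewrite N_ge0 N_comb_le.
- exact: cvg_cst.
rewrite [X in _ --> X](_ : 0 = \sum_(j < M) `|0 : R| * N (g j)); last first.
  by rewrite big1// => j _; rewrite normr0 mul0r.
apply: cvg_big => [|j _]; first exact: add_continuous.
by apply: cvgM; [exact: cvg_norm|exact: cvg_cst].
Qed.

End SpanNorm.

(** * Convergence of the empirical Galerkin projection *)

Theorem lemma2 (R : realType) (p M : nat) (Z : set 'rV[R]_p) (Z0 : Z 0)
  (mu : probability (phase Z0) R)
  (F : 'rV[R]_p -> 'rV[R]_p) (lambda : R) (w : 'cV[R]_p)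
  (gam : 'I_M -> 'rV[R]_p -> R)
  (F_smooth : smooth_near Z F) (F_equilibrium : F 0 = 0)
  (w_neq0 : w != 0) (w_left_eigen : w^T *m Emx F = lambda *: w^T)
  (gam_differentiable : forall j z, Z z -> differentiable (gam j) z)
  (gam_L2 : forall j, (gam j \o @pt _ _ _ Z0) \in Lfun mu 2%:E)
  (koop_L2 : forall j, (koop F lambda gam j \o @pt _ _ _ Z0) \in Lfun mu 2%:E)
  (wFn_L2 : (wFn F w \o @pt _ _ _ Z0) \in Lfun mu 2%:E)
  (gam_indep : mu_lin_indep mu (fun j => gam j \o @pt _ _ _ Z0))
  (koop_indep : mu_lin_indep mu (fun j => koop F lambda gam j \o @pt _ _ _ Z0))
  (Jmu_invertible : Jmu F lambda gam mu \in unitmx)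
  (d : measure_display) (Omega : measurableType d) (P : probability Omega R)
  (X : nat -> {RV P >-> phase Z0}) (X_iid : iid mu X)
  (N : (phase Z0 -> R) -> R)
  (N_norm : norm_on (span_fct (fun j => gam j \o @pt _ _ _ Z0)) N) :
  {ae P, forall omega : Omega,
    N (psi w gam (ThetaL F w lambda gam (fun k : 'I_L => X k omega))
       - psi w gam (Theta F w lambda gam mu)) @[L --> \oo] --> (0 : R)}.
Proof.
have X_pw := iid_pairwise X_iid.
pose gZ j := gam j \o @pt _ _ _ Z0.
have int_mul f g : f \in Lfun mu 2%:E -> g \in Lfun mu 2%:E ->
    mu.-integrable [set: phase Z0] (EFin \o (f \* g)).
  by move=> f2 g2; apply/Lfun1_integrable; exact: Lfun2_mul_Lfun1.
(* Each entry is the sample mean of a product of two L2 functions, integrable by the Cauchy-Schwarz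
   inequality; finitely many entries share one null set. *)
have J_cvg : {ae P, forall omega, forall i j,
    Jhat F lambda gam (fun k : 'I_L => X k omega) i j @[L --> \oo] -->
      Jmu F lambda gam mu i j}.
  apply: filter_forall => i; apply: filter_forall => j.
  have kg_int := int_mul _ _ (koop_L2 j) (gam_L2 i).
  apply: filterS (strong_law X_pw kg_int) => omega.
  rewrite mxE => H; apply: cvg_trans H; apply: near_eq_cvg; apply: nearW => L.
  rewrite !mxE summxE mulrC; congr (_ * _); apply: eq_bigr => k _.
  by rewrite mxE big_ord1 !mxE mulrC.
have b_cvg : {ae P, forall omega, forall i,
    bhat F w gam (fun k : 'I_L => X k omega) i 0 @[L --> \oo] -->
      bmu F w gam mu i 0}.
  apply: filter_forall => i.
  apply: filterS (strong_law X_pw (int_mul _ _ wFn_L2 (gam_L2 i))) => omega.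
  rewrite mxE => H; apply: cvg_trans H; apply: near_eq_cvg; apply: nearW => L.
  rewrite !mxE summxE mulrC; congr (_ * _); apply: eq_bigr => k _.
  by rewrite !mxE.
apply: filterS2 J_cvg b_cvg => omega J_cvg b_cvg.
(* The linear parts cancel, so the difference lies in the span, where [N] is a norm. *)
have psiE t1 t2 : psi w gam t1 - psi w gam t2 =
    (fun z : phase Z0 => \sum_(j < M) (t1 - t2) j 0 * gZ j z).
  apply/funext => z; rewrite -[LHS]/(psi w gam t1 z - psi w gam t2 z) /psi.
  rewrite opprD addrACA subrr add0r.
  rewrite 2!mxE -sumrB; apply: eq_bigr => j _.
  by rewrite !mxE -mulrBr mulrC.
under eq_fun do rewrite psiE.
apply: (cvg_span_norm N_norm) => j.
rewrite -[X in _ --> X](subrr (Theta F w lambda gam mu j 0)).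
under eq_fun do rewrite mxE [X in _ + X]mxE.
apply: cvgB; last exact: cvg_cst.
rewrite mxE; under eq_fun do rewrite mxE.
(* The limit [Jmu] is invertible, so singular empirical matrices can occur along this sample for
   finitely many [L] only and do not affect the limit. *)
apply: cvgN; apply: cvg_mulmx => [i k|i k]; first exact: cvg_invmx.
by rewrite ord1; exact: b_cvg.
Qed.
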